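(* Let $n \geq 2$ be an integer and let $P(z)=\sum_{k=0}^{n} a_k z^k$ be a complex polynomial of degree $n$ with nonzero coefficients, i.e. $a_k \in \mathbb{C}\setminus\{0\}$ for all $k=0,1,\ldots,n$. If $|q_k(P)| \geq b_{\infty}$ for all $k = 2, 3, \ldots, n$, then all the zeros of $P$ are simple. Moreover, the moduli of all zeros of $P$ are pairwise different.
   Context: For a polynomial $P(z)=\sum_{k=0}^{n} a_k z^k$ with all coefficients $a_k \in \mathbb{C}\setminus\{0\}$, the second quotients of its coefficients are $q_k(P) = \dfrac{a_{k-1}^2}{a_{k-2}a_k}$ for $2 \le k \le n$. $b_\infty$ denotes the unique root $x>1$ of the equation $1 - 2\sum_{k=1}^{\infty} x^{-k^2/2} = 0$ (the series converges for $x > 1$); numerically $b_\infty \approx 4.81058280$. *)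

(* Defs.v *)
From HB Require Import structures.
From mathcomp Require Import all_boot all_order all_algebra.
From mathcomp Require Import zify ring lra complex.
From mathcomp Require Import all_classical all_reals all_analysis.

Set Implicit Arguments.
Unset Strict Implicit.
Unset Printing Implicit Defensive.

Import Order.TTheory GRing.Theory Num.Theory.
Import numFieldNormedType.Exports.

Local Open Scope classical_set_scope.
Local Open Scope ring_scope.

(* Meant for 2 <= k <= size P - 1: the subtractions on indices are truncated. *)
Definition second_quotient (F : fieldType) (P : {poly F}) (k : nat) : F :=
  P`_(k - 1) ^+ 2 / (P`_(k - 2) * P`_k).

Definition is_b_infty (R : realType) (x : R) : Prop :=
  1 < x /\ 1 - 2 * \big[+%R/0]_(1 <= k <oo) x `^ (- (k%:R ^+ 2 / 2)) = 0.

Definition b_infty (R : realType) : R := xget 0 [set x | is_b_infty x].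

(* There is exactly one such [x], so the default value of [xget] is not used.
   The proof substitutes [t = x `^ (- 2^-1)]. *)
Section b_infty_exists_unique.
Variable R : realType.
Implicit Types (x s t : R) (n : nat).

Let S n t : R := \sum_(1 <= k < n) t ^+ (k ^ 2).
Let G t : R := limn (S ^~ t).

Let S_cvg t : 0 <= t -> t < 1 -> cvgn (S ^~ t).
Proof.
move=> t0 t1; rewrite /S (is_cvg_series_restrict 1%N (fun k => t ^+ (k ^ 2))).
apply: (@series_le_cvg _ _ (geometric 1 t)).
- by move=> k; rewrite exprn_ge0.
- by move=> k; rewrite /= mul1r exprn_ge0.
- move=> k; rewrite /= mul1r ler_wiXn2l //; first exact: ltW.
  by rewrite -mulnn; case: k => // k; rewrite leq_pmulr.
- by apply: is_cvg_geometric_series; rewrite ger0_norm.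
Qed.

Let S_incr n s t : 0 <= s -> s <= t -> (1 < n)%N -> t - s <= S n t - S n s.
Proof.
move=> s0 st n1; rewrite /S -sumrB big_ltn //= !expr1 lerDl sumr_ge0 // => k _.
by rewrite subr_ge0 lerXn2r // nnegrE // (le_trans s0).
Qed.

Let G_incr s t : 0 <= s -> s <= t -> t < 1 -> t - s <= G t - G s.
Proof.
move=> s0 st t1; have t0 := le_trans s0 st.
have cs := S_cvg s0 (le_lt_trans st t1); have ct := S_cvg t0 t1.
rewrite -limB //; apply: limr_ge; first exact: is_cvgB.
by near=> n; apply: S_incr => //; near: n; exists 2%N.
Unshelve. all: by end_near. Qed.

Let expr_lip m s t : 0 <= s -> s <= t ->
  t ^+ m.+1 - s ^+ m.+1 <= (t - s) * (m.+1%:R * t ^+ m).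
Proof.
move=> s0 st; have t0 := le_trans s0 st.
rewrite subrXX ler_wpM2l ?subr_ge0 //.
rewrite (@le_trans _ _ (\sum_(i < m.+1) t ^+ m)) //; last first.
  by rewrite sumr_const card_ord mulr_natl.
apply: ler_sum => i _.
have -> : t ^+ m = t ^+ (m.+1.-1 - i) * t ^+ i by rewrite -exprD subnK // -ltnS.
by rewrite ler_wpM2l ?exprn_ge0 // lerXn2r.
Qed.

Let S_lip n s t : 0 <= s -> s <= t -> t <= 2^-1 ->
  S n.+1 t - S n.+1 s <= 2 * (t - s).
Proof.
move=> s0 st t2; have t0 := le_trans s0 st.
suff: S n.+1 t - S n.+1 s <= (t - s) * (2 - 2 * 2^-1 ^+ n).
  move/le_trans; apply; rewrite mulrC ler_wpM2r ?subr_ge0 //.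
  by rewrite gerBl mulr_ge0 // exprn_ge0.
rewrite /S -sumrB; elim: n => [|n IHn].
  by rewrite big_geq // expr0 mulr1 subrr mulr0.
rewrite big_nat_recr //=.
have -> : (t - s) * (2 - 2 * 2^-1 ^+ n.+1) =
          (t - s) * (2 - 2 * 2^-1 ^+ n) + (t - s) * 2^-1 ^+ n.
  by rewrite exprS; field.
apply: lerD => //.
have -> : (n.+1 ^ 2 = (n * n.+1 + n).+1)%N by rewrite -mulnn; lia.
apply: (le_trans (expr_lip _ s0 st)); rewrite ler_wpM2l ?subr_ge0 //.
have le2 : ((n * n.+1 + n).+1 <= 2 ^ (n * n.+1))%N.
  have n2 : (n < 2 ^ n)%N by exact: ltn_expl.
  case: n n2 {IHn} => // n n2.
  have : (n.+2 * n.+2 <= 2 ^ n.+1 * 2 ^ n.+1)%N by exact: leq_mul.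
  rewrite -expnD => h; have : (2 ^ (n.+1 + n.+1) <= 2 ^ (n.+1 * n.+2))%N.
    by rewrite leq_exp2l //; nia.
  by move: h; nia.
rewrite (@le_trans _ _ ((2 ^ (n * n.+1))%:R * 2^-1 ^+ (n * n.+1 + n))) //.
  apply: ler_pM; rewrite ?exprn_ge0 ?ler_nat // lerXn2r // nnegrE //.
by rewrite exprD mulrA natrX -exprMn divff // expr1n mul1r.
Qed.

Let G_lip s t : 0 <= s -> s <= t -> t <= 2^-1 -> G t - G s <= 2 * (t - s).
Proof.
move=> s0 st t2; have t0 := le_trans s0 st.
have t1 : t < 1 by apply: le_lt_trans t2 _; lra.
have cs := S_cvg s0 (le_lt_trans st t1); have ct := S_cvg t0 t1.
rewrite -limB //; apply: limr_le; first exact: is_cvgB.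
near=> n; have n0 : (0 < n)%N by near: n; exists 1%N.
by rewrite -(prednK n0); exact: S_lip.
Unshelve. all: by end_near. Qed.

Let G_root : exists2 t, 0 < t < 1 & G t = 2^-1.
Proof.
pose c x : R := Num.max 0 (Num.min x 2^-1).
have c_itv x : 0 <= c x <= 2^-1.
  by rewrite /c le_max lexx /= ge_max ge_min lexx orbT andbT.
have c_lip x y : x <= y -> c x <= c y /\ c y - c x <= y - x.
  rewrite /c => xy; case: (leP x 2^-1) => ?; case: (leP y 2^-1) => ?;
  case: (leP 0 x) => ?; case: (leP 0 y) => ?; case: (leP 0 (2^-1 : R)) => ?;
  by split; lra.
have Gc_lip x y : x <= y -> `|G (c x) - G (c y)| <= 2 * (y - x).
  move=> xy; have [cxy lexy] := c_lip _ _ xy.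
  have /andP[cx0 _] := c_itv x; have /andP[_ cy1] := c_itv y.
  have cy1' : c y < 1 by lra.
  have := G_lip cx0 cxy cy1; have := G_incr cx0 cxy cy1'.
  move=> h1 h2; rewrite distrC ger0_norm; lra.
have Gc_cts : continuous (G \o c).
  move=> x; apply/cvgrPdist_le => e e0; near=> y => /=.
  have xy : `|x - y| <= e / 2.
    by near: y; apply: cvgr_dist_le; [exact: cvg_id|rewrite divr_gt0].
  have [lexy|/ltW leyx] := leP x y.
    by apply: (le_trans (Gc_lip _ _ lexy)); move: xy; rewrite distrC ger0_norm; lra.
  rewrite distrC; apply: (le_trans (Gc_lip _ _ leyx)).
  by move: xy; rewrite ger0_norm; lra.
have G0 : G 0 = 0.
  rewrite /G; have -> : S ^~ 0 = fun=> 0 :> R; last exact: lim_cst.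
  apply/funext => n; rewrite /S big_nat_cond big1 // => k /andP[/andP[k1 _] _].
  by rewrite expr0n expn_eq0 (gtn_eqF k1).
have Ghalf : 2^-1 <= G 2^-1.
  have : 2^-1 - 0 <= G 2^-1 - G 0 by apply: G_incr; lra.
  by rewrite G0 !subr0.
have c0 : c 0 = 0 by rewrite /c min_l ?maxxx // invr_ge0.
have ch : c 2^-1 = 2^-1 by rewrite /c minxx max_r // invr_ge0.
have [||x xin Gx] := @IVT R (G \o c) 0 2^-1 2^-1 _ (continuous_subspaceT Gc_cts).
- lra.
- by rewrite /= c0 ch G0 ge_min le_max Ghalf orbT andbT invr_ge0 ler0n.
exists (c x) => //; have /andP[cx0 cx1] := c_itv x.
apply/andP; split; last lra.
rewrite lt_neqAle cx0 andbT; apply/eqP => cE; move: Gx => /=.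
by rewrite -cE G0 => /eqP; rewrite eq_sym invr_eq0 pnatr_eq0.
Unshelve. all: by end_near. Qed.

Let is_b_inftyE x : 0 < x ->
  1 - 2 * \big[+%R/0]_(1 <= k <oo) x `^ (- (k%:R ^+ 2 / 2)) =
  1 - 2 * G (x `^ (- 2^-1)).
Proof.
move=> x0; suff -> : (fun n => \sum_(1 <= k < n) x `^ (- (k%:R ^+ 2 / 2))) =
  S ^~ (x `^ (- 2^-1)) by [].
apply/funext => n; apply: eq_bigr => k _.
rewrite -powR_mulrn ?powR_ge0 // -powRrM; congr (x `^ _).
by rewrite natrX mulNr mulrC.
Qed.

Lemma b_infty_exists_unique : exists! x, is_b_infty x.
Proof.
have [t /andP[t0 t1] Gt] := G_root.
exists (t ^- 2); split.
  have tx : (t ^- 2) `^ (- 2^-1) = t.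
    rewrite powRN powR12_sqrt ?invr_ge0 ?exprn_ge0 ?ltW //.
    by rewrite -exprVn sqrtr_sqr ger0_norm ?invrK // invr_ge0 ltW.
  have x1 : 1 < t ^- 2.
    by rewrite -exprVn exprn_egt1 // invf_gt1.
  by split => //; rewrite is_b_inftyE ?(lt_trans ltr01) // tx Gt mulfV // subrr.
move=> x [x1]; have x0 : 0 < x := lt_trans ltr01 x1.
rewrite is_b_inftyE //.
have s0 : 0 < x `^ (- 2^-1) by exact: powR_gt0.
have xs : x = (x `^ (- 2^-1)) ^- 2.
  by rewrite -exprVn -powRN opprK powR12_sqrt ?sqr_sqrtr // ltW.
move: (x `^ _) s0 xs => s s0 xs Gs.
have s1 : s < 1.
  have : 1 < s^-1 ^+ 2 by move: x1; rewrite {1}xs -exprVn.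
  by rewrite expr_gt1 ?invr_ge0 ?ltW // invf_gt1.
rewrite xs; congr (_ ^- 2).
have [st|/ltW ts] := leP s t.
  by have := G_incr (ltW s0) st t1; lra.
by have := G_incr (ltW t0) ts s1; lra.
Qed.

Lemma b_inftyP : is_b_infty (b_infty R).
Proof.
by have [x [xP _]] := b_infty_exists_unique; exact: (xgetPex 0 (ex_intro _ x xP)).
Qed.

End b_infty_exists_unique.

(* Main.v *)
(* Put [t = b_infty `^ (- 1/2)], so that the sums [t + t^4 + ... + t^(m^2)] are
   all [< 1/2], and let [rho_k] be the geometric mean of the radii at which the
   moduli of the terms [k - 1], [k] and [k], [k + 1] of [P] agree, for
   [0 < k < n].  On [|z| = rho_k] the moduli of the terms of index [k +/- j] are
   at most [t^(j^2)] times that of the term of index [k], which thus exceeds the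
   sum of all the others.  By Pellet's theorem, [P] has then exactly [k] zeros in
   [|z| < rho_k] and none on its boundary, so that consecutive radii isolate the
   zeros of [P].

   Pellet's theorem is obtained without complex analysis.  If [P] has more than
   [k] zeros in [|z| < rho], then the linear recurrence of characteristic
   polynomial [P] has a nonzero solution [u] with [u_0 = ... = u_(k-1) = 0] and
   [|u_s| <= C rho^s]; but the dominance of the term [k] allows one to replace [C]
   by [c C] with a fixed [c < 1], whence [u = 0].  The reciprocal polynomial gives
   the bound [n - k] on the number of zeros in [|z| > rho]. *)

Require Import Defs.
From mathcomp Require Import all_boot all_order all_algebra.
From mathcomp Require Import zify ring lra complex.
From mathcomp Require Import all_classical all_reals all_analysis.

Import Order.TTheory GRing.Theory Num.Theory.
Import numFieldNormedType.Exports.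
Local Open Scope classical_set_scope.
Local Open Scope ring_scope.
Local Open Scope complex_scope.

(** * Linear recurrences as polynomials in the shift operator *)

Section LinearRecurrence.
Context {K : idomainType}.
Implicit Types (p q : {poly K}) (u v : nat -> K).

(** This is [p(E) u] at [s], with [E] the shift of sequences; its kernel consists of the solutions
    of the recurrence of characteristic polynomial [p]. *)
Definition rec_op p u (s : nat) : K := \sum_(j < size p) p`_j * u (s + j)%N.

Lemma rec_op_wide p u s m : (size p <= m)%N ->
  rec_op p u s = \sum_(j < m) p`_j * u (s + j)%N.
Proof.
move=> pm; rewrite /rec_op (big_ord_widen m (fun j => p`_j * u (s + j)%N)) //.
rewrite big_mkcond; apply: eq_bigr => j _; case: ltnP => // /(nth_default 0) ->.
by rewrite mul0r.
Qed.

Lemma rec_op0 p s : rec_op p (fun=> 0) s = 0.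
Proof. by rewrite /rec_op big1 // => j _; rewrite mulr0. Qed.

Lemma rec_opMXaddC p c u s :
  rec_op (p * 'X + c%:P) u s = rec_op p u s.+1 + c * u s.
Proof.
rewrite (@rec_op_wide _ _ _ (size p).+1); last first.
  by rewrite size_MXaddC; case: ifP.
rewrite big_ord_recl coefD coefC coefMX /= add0r addn0 addrC; congr (_ + _).
apply: eq_bigr => j _; rewrite coefD coefC coefMX /= addr0 /bump /=.
by rewrite add1n addnS.
Qed.

Lemma rec_opD p q u s : rec_op (p + q) u s = rec_op p u s + rec_op q u s.
Proof.
rewrite (@rec_op_wide _ _ _ _ (size_polyD p q)) (rec_op_wide p _ _ _ (leq_maxl _ (size q))).
rewrite (rec_op_wide q _ _ _ (leq_maxr (size p) _)) -big_split /=.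
by apply: eq_bigr => j _; rewrite coefD mulrDl.
Qed.

Lemma rec_opZ c p u s : rec_op (c *: p) u s = c * rec_op p u s.
Proof.
rewrite (rec_op_wide _ _ _ _ (size_scale_leq c p)) /rec_op mulr_sumr.
by apply: eq_bigr => j _; rewrite coefZ mulrA.
Qed.

(** Used to pass from a solution for a factor of [P] to a solution for [P]. *)
Lemma rec_opM p q u s : rec_op (p * q) u s = rec_op p (rec_op q u) s.
Proof.
elim/poly_ind: p s => [|p c IHp] s.
  by rewrite mul0r /rec_op size_poly0 !big_ord0.
rewrite mulrDl mulrAC -['X in LHS]addr0 mul_polyC rec_opD rec_opZ rec_opMXaddC -IHp.
have := rec_opMXaddC (p * q) 0 u s.
by rewrite addr0 polyC0 addr0 mul0r addr0 => ->.
Qed.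

Lemma rec_op_XsubC z u s : rec_op ('X - z%:P) u s = u s.+1 - z * u s.
Proof.
by rewrite /rec_op size_XsubC !big_ord_recl big_ord0 /= !coefB !coefX !coefC
  /= /bump /= addr0 addn0 addn1 !add0r subr0 mul1r mulNr addrC.
Qed.

End LinearRecurrence.

(** * Reciprocal polynomials *)

Section Reversal.
Context {F : fieldType}.
Implicit Types (p : {poly F}) (rs : seq F).

(** For [size p <= d.+1] this is [X^d p(1/X)]. *)
Definition rev_poly d p : {poly F} := \poly_(i < d.+1) p`_(d - i).

Lemma rev_polyMXsubC d p z : (size p <= d.+1)%N ->
  rev_poly d.+1 (p * ('X - z%:P)) = rev_poly d p * (1 - z%:P * 'X).
Proof.
move=> pd; apply/polyP => i.
rewrite [in RHS]mulrBr mulr1 mulrA coefB coefMX coefMC !coef_poly.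
rewrite mulrBr coefB coefMC coefMX.
case: i => [|i] /=.
  by rewrite !subn0 (nth_default 0 pd) mul0r.
rewrite !ltnS subSS; case: ltngtP => [id|di|->]; last by rewrite subnn.
  by rewrite subn_eq0 leqNgt id subnS.
by rewrite mul0r subrr.
Qed.

(** Reversal turns each factor [X - z] into [1 - z X = - z (X - 1/z)]. *)
Lemma rev_poly_prod rs : 0 \notin rs ->
  exists2 c, c != 0 & rev_poly (size rs) (\prod_(z <- rs) ('X - z%:P)) =
    c *: \prod_(z <- map GRing.inv rs) ('X - z%:P).
Proof.
elim: rs => [|z rs IHrs] /=.
  exists 1; rewrite ?oner_eq0 // !big_nil scale1r; apply/polyP => i.
  by rewrite coef_poly !coef1 sub0n; case: i.
rewrite inE negb_or eq_sym => /andP[z0 /IHrs[c c0 E]].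
have E1 : 1 - z%:P * 'X = - z *: ('X - z^-1%:P) :> {poly F}.
  by rewrite scalerBr !scaleNr -!mul_polyC -polyCM divff // opprK addrC.
exists (- z * c); first by rewrite mulf_neq0 // oppr_eq0.
rewrite !big_cons mulrC rev_polyMXsubC ?size_prod_XsubC // E E1.
by rewrite -scalerAr -scalerAl scalerA; congr (_ *: _); rewrite mulrC.
Qed.

End Reversal.

(** Pellet's condition on the circle of radius [rho], where [A j] stands for the modulus of the
    coefficient of index [j]. *)
Definition dominant_term {R : realType} n (A : nat -> R) k (rho : R) :=
  \sum_(j < n.+1 | j != k :> nat) A j * rho ^+ j < A k * rho ^+ k.

(** * Pellet's theorem through the growth of recurrent sequences *)

Section Pellet.
Context {R : realType}.
Implicit Types (P Q : {poly R[i]}) (rs : seq R[i]) (u : nat -> R[i]).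
Local Notation nu := (@Normc.normc R).

Lemma normc_ge0 (z : R[i]) : 0 <= nu z.
Proof. by case: z => a b; exact: sqrtr_ge0. Qed.

Lemma normc_eq0 (z : R[i]) : (nu z == 0) = (z == 0).
Proof. by apply/eqP/eqP => [/Normc.eq0_normc|->]; rewrite ?Normc.normc0. Qed.

Lemma normc_gt0 (z : R[i]) : (0 < nu z) = (z != 0).
Proof. by rewrite lt0r normc_eq0 normc_ge0 andbT. Qed.

Lemma normcX (z : R[i]) n : nu (z ^+ n) = nu z ^+ n.
Proof.
by elim: n => [|n IHn]; rewrite ?expr0 ?Normc.normc1 // !exprS Normc.normcM IHn.
Qed.

Lemma normc_sum (I : Type) (r : seq I) (D : pred I) (f : I -> R[i]) :
  nu (\sum_(i <- r | D i) f i) <= \sum_(i <- r | D i) nu (f i).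
Proof.
elim/big_rec2: _ => [|i y x _ xy]; first by rewrite Normc.normc0.
by apply: (le_trans (le_normcD _ _)); rewrite lerD2l.
Qed.

(** Convolution of [u] with the powers of [z], delayed by one step: it inverts the operator of
    ['X - z%:P] and adds one initial zero. *)
Fixpoint first_order_solution (z : R[i]) u (s : nat) : R[i] :=
  if s is s'.+1 then z * first_order_solution z u s' + u s' else 0.

(** The powers of [z] settle a single root. Each further root [y] is absorbed by
    [first_order_solution y], which keeps the growth rate [rho] because [nu y < rho]. *)
Lemma impulse_response z rs (rho : R) : all (fun w => nu w < rho) (z :: rs) ->
  exists u, [/\ forall i, (i < size rs)%N -> u i = 0, u (size rs) = 1,
    forall s, rec_op (\prod_(w <- z :: rs) ('X - w%:P)) u s = 0 &
    exists C, forall s, nu (u s) <= C * rho ^+ s].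
Proof.
elim: rs => [|y rs IHrs] /=.
  rewrite andbT => zr; exists (GRing.exp z); split => //.
    by move=> s; rewrite big_seq1 rec_op_XsubC exprS subrr.
  exists 1 => s; rewrite mul1r normcX lerXn2r ?nnegrE ?normc_ge0 //.
    exact: le_trans (normc_ge0 z) (ltW zr).
  exact: ltW.
rewrite andbCA => /andP[yr /IHrs[u [u0 u1 uQ [C uC]]]].
exists (first_order_solution y u); split.
- elim=> //= i IHi ir; rewrite IHi; last exact: ltnW.
  by rewrite mulr0 add0r u0.
- suff /= -> : first_order_solution y u (size rs) = 0 by rewrite mulr0 add0r.
  have: (size rs <= size rs)%N by [].
  elim: {1 3}(size rs) => //= i IHi ir; rewrite IHi; last exact: ltnW.
  by rewrite mulr0 add0r u0.
(* The factors are reordered so that the one of [y] acts first and gives back [u]. *)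
- move=> s; rewrite !big_cons mulrCA mulrC rec_opM -[RHS](uQ s) big_cons.
  congr rec_op; apply/funext => i.
  by rewrite rec_op_XsubC /= addrAC subrr add0r.
(* This constant [D] solves [D * rho = nu y * D + C], which makes the induction close. *)
exists (C / (rho - nu y)); elim=> [|s IHs]; rewrite [first_order_solution _ _ _]/=.
  rewrite Normc.normc0 expr0 mulr1 divr_ge0 ?subr_ge0 ?(ltW yr) //.
  by have := uC 0%N; rewrite expr0 mulr1; exact: le_trans (normc_ge0 _).
apply: (le_trans (le_normcD _ _)); rewrite Normc.normcM.
have -> : C / (rho - nu y) * rho ^+ s.+1 =
   nu y * (C / (rho - nu y) * rho ^+ s) + C * rho ^+ s.
  by rewrite exprS; field; rewrite subr_eq0 gt_eqF.
by apply: lerD => //; rewrite ler_wpM2l ?normc_ge0.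
Qed.

Lemma dominant_rec_op_eq0 n P k (rho : R) u : 0 < rho -> (size P <= n.+1)%N ->
  (k <= n)%N -> dominant_term n (fun j => nu P`_j) k rho ->
  (forall s, rec_op P u s = 0) -> (forall i, (i < k)%N -> u i = 0) ->
  (exists C, forall s, nu (u s) <= C * rho ^+ s) ->
  forall s, u s = 0.
Proof.
move=> rho0 Pn kn dom Pu uk [C uC].
have C0 : 0 <= C.
  by have := uC 0%N; rewrite expr0 mulr1; exact: le_trans (normc_ge0 _).
pose sg := \sum_(j < n.+1 | j != k :> nat) nu P`_j * rho ^+ j.
have sg0 : 0 <= sg.
  by apply: sumr_ge0 => j _; rewrite mulr_ge0 ?normc_ge0 ?exprn_ge0 ?ltW.
have top0 : 0 < nu P`_k * rho ^+ k by exact: le_lt_trans sg0 dom.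
have Pk0 : 0 < nu P`_k by move: top0; rewrite pmulr_lgt0 // exprn_gt0.
pose c := sg / (nu P`_k * rho ^+ k).
have c0 : 0 <= c by rewrite divr_ge0 // ltW.
have c1 : c < 1 by rewrite ltr_pdivrMr // mul1r.
have step D : 0 <= D -> (forall s, nu (u s) <= D * rho ^+ s) ->
    forall s, nu (u s) <= (D * c) * rho ^+ s.
  move=> D0 uD s; have [sk|ks] := ltnP s k.
    rewrite uk // Normc.normc0 mulr_ge0 //; first exact: mulr_ge0.
    by rewrite exprn_ge0 // ltW.
  rewrite -(ler_pM2l Pk0) -Normc.normcM.
  (* Taken at [s - k], the recurrence expresses the term in [u s] through the others, each bounded
     with the constant [D]; the initial zeros have settled [s < k]. *)
  have := Pu (s - k)%N; rewrite (rec_op_wide _ _ _ _ Pn).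
  rewrite (bigD1 (Ordinal (kn : (k < n.+1)%N))) //= subnK // => /eqP.
  rewrite addr_eq0 => /eqP ->; rewrite normcN; apply: le_trans (normc_sum _ _ _ _) _.
  have -> : nu P`_k * (D * c * rho ^+ s) = D * rho ^+ (s - k) * sg.
    rewrite /c -{1}(subnK ks) exprD; field.
    by rewrite !gt_eqF // exprn_gt0.
  rewrite /sg mulr_sumr; apply: ler_sum => j _.
  rewrite Normc.normcM mulrCA ler_wpM2l ?normc_ge0 //.
  by rewrite -mulrA -exprD.
have geo N s : nu (u s) <= C * c ^+ N * rho ^+ s.
  elim: N s => [|N IHN] s; first by rewrite expr0 mulr1.
  by rewrite exprSr mulrA; apply: step => //; rewrite mulr_ge0 ?exprn_ge0.
move=> s; apply/eqP; rewrite -normc_eq0 eq_le normc_ge0 andbT.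
have lim0 : (fun N => C * rho ^+ s * c ^+ N) @ \oo --> 0.
  by apply: cvg_geometric; rewrite ger0_norm.
rewrite -(cvg_lim (@Rhausdorff R) lim0) //; apply: limr_ge; first by apply/cvg_ex; exists 0.
by apply: nearW => N; rewrite mulrAC; exact: geo.
Qed.

(** With more than [k] roots, the impulse response of the factor would start with at least [k]
    zeros, hence vanish by [dominant_rec_op_eq0], yet it takes the value 1. *)
Lemma dominant_inner_factor n P Q k (rho : R) rs : 0 < rho -> (k <= n)%N ->
  P = Q * \prod_(z <- rs) ('X - z%:P) -> (size P <= n.+1)%N ->
  dominant_term n (fun j => nu P`_j) k rho ->
  all (fun z => nu z < rho) rs -> (size rs <= k)%N.
Proof.
move=> rho0 kn.
case: rs => [//|z rs] PE Pn dom /impulse_response[u [u0 u1 uQ uC]].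
rewrite leqNgt; apply/negP => krs.
have := @dominant_rec_op_eq0 n P k rho u rho0 Pn kn dom _ _ uC (size rs).
rewrite u1 => one0; apply: (elimN eqP (oner_neq0 R[i])); apply: one0 => [s|i ik].
  rewrite PE rec_opM -[RHS](rec_op0 Q s); congr rec_op.
  exact/funext.
by apply: u0; exact: leq_trans ik _.
Qed.

Lemma dominant_count_lt n P (c : R[i]) k (rho : R) rs : 0 < rho -> (k <= n)%N ->
  P = c *: \prod_(z <- rs) ('X - z%:P) -> (size P <= n.+1)%N ->
  dominant_term n (fun j => nu P`_j) k rho ->
  (count (fun z => nu z < rho)%R rs <= k)%N.
Proof.
move=> rho0 kn PE Pn dom; rewrite -size_filter.
set a := (fun z => nu z < rho)%R.
have PE' : P = (c *: \prod_(z <- rs | ~~ a z) ('X - z%:P)) *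
   \prod_(z <- seq.filter a rs) ('X - z%:P).
  by rewrite PE (bigID a) /= big_filter mulrC scalerAl.
apply: (dominant_inner_factor n P _ k rho _ rho0 kn PE' Pn dom); exact: filter_all.
Qed.

Lemma dominant_term_rev n (A : nat -> R) k (rho : R) : 0 < rho -> (k <= n)%N ->
  dominant_term n A k rho ->
  dominant_term n (fun j => A (n - j)%N) (n - k) rho^-1.
Proof.
move=> rho0 kn; rewrite /dominant_term subKn // => dom.
have r0 : rho != 0 by rewrite gt_eqF.
(* Multiplying by [rho ^+ n] turns the powers of [rho^-1] of exponent [n - i] into [rho ^+ i]. *)
rewrite -(ltr_pM2r (exprn_gt0 n rho0)) mulr_suml.
have E i : (i <= n)%N -> rho^-1 ^+ (n - i) * rho ^+ n = rho ^+ i.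
  move=> ni; rewrite -{2}(subnK ni) exprD mulrA exprVn mulVf ?mul1r //.
  by rewrite expf_neq0.
rewrite -mulrA E // (reindex_inj rev_ord_inj) /=.
apply: le_lt_trans dom; rewrite le_eqVlt; apply/orP; left; apply/eqP.
apply: eq_big => [i|i _].
  by have := ltn_ord i; lia.
by rewrite subSS -mulrA E ?subKn // -ltnS.
Qed.

Lemma dominant_count_gt n P (c : R[i]) k (rho : R) rs : 0 < rho -> (k <= n)%N ->
  P = c *: \prod_(z <- rs) ('X - z%:P) -> size rs = n -> 0 \notin rs ->
  dominant_term n (fun j => nu P`_j) k rho ->
  (count (fun z => rho < nu z)%R rs <= n - k)%N.
Proof.
move=> rho0 kn PE rsn rs0 /(dominant_term_rev _ _ _ _ rho0 kn) dom.
have [d d0] := rev_poly_prod _ rs0; rewrite rsn => E.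
have E' : rev_poly n P = (c * d) *: \prod_(z <- map GRing.inv rs) ('X - z%:P).
  rewrite -scalerA -E; apply/polyP => i; rewrite PE coefZ !coef_poly coefZ.
  by case: ifP; rewrite ?mulr0.
have -> : count (fun z => rho < nu z) rs =
    count (fun z => nu z < rho^-1)%R (map GRing.inv rs).
  rewrite count_map; apply: eq_in_count => z zrs /=.
  have z0 : 0 < nu z by rewrite normc_gt0; apply: contraNneq rs0 => <-.
  by rewrite Normc.normcV ltf_pV2.
apply: (dominant_count_lt n _ _ _ _ _ _ _ E'); rewrite ?invr_gt0 ?leq_subr //.
  by rewrite size_poly.
apply: le_lt_trans (lt_le_trans dom _); last first.
  by rewrite coef_poly ltnS leq_subr.
apply: ler_sum => j _.
by rewrite coef_poly ltn_ord.
Qed.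

Lemma dominant_not_root n P k (rho : R) z : (size P <= n.+1)%N -> (k <= n)%N ->
  dominant_term n (fun j => nu P`_j) k rho -> root P z -> nu z != rho.
Proof.
move=> Pn kn dom /eqP; rewrite (horner_coef_wide _ Pn).
rewrite (bigD1 (Ordinal (kn : (k < n.+1)%N))) //= => /eqP.
rewrite addr_eq0 => /eqP E; apply/negP => /eqP zr; move: dom.
rewrite /dominant_term -zr -normcX -Normc.normcM E normcN ltNge => /negP; apply.
apply: le_trans (normc_sum _ _ _ _) _; apply: ler_sum => j _.
by rewrite Normc.normcM normcX.
Qed.

End Pellet.

(** * Radii on which one term dominates *)

Section Dominance.
Context {R : realType}.

Lemma b_infty_theta : exists2 t : R, 0 < t &
  t ^- 2 = b_infty R /\ forall m, \sum_(1 <= j < m) t ^+ (j ^ 2) < 2^-1.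
Proof.
have [b1 bE] := b_inftyP R; set b := b_infty R in b1 bE *.
have b0 : 0 < b := lt_trans ltr01 b1.
pose t := b `^ (- 2^-1); have t0 : 0 < t by exact: powR_gt0.
have bt : t ^- 2 = b.
  by rewrite -exprVn -powRN opprK powR12_sqrt ?sqr_sqrtr // ltW.
exists t => //; split=> // m.
pose S n := \sum_(1 <= j < n) t ^+ (j ^ 2).
have SE : (fun n => \sum_(1 <= k < n) b `^ (- (k%:R ^+ 2 / 2))) = S.
  apply/funext => n; apply: eq_bigr => k _.
  rewrite -powR_mulrn ?powR_ge0 // -powRrM; congr (b `^ _).
  by rewrite natrX mulNr mulrC.
have Slim : limn S = 2^-1 by move: bE; rewrite SE; lra.
(* [lim] of a divergent sequence is [0]. *)
have Scvg : cvgn S.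
  apply: contrapT => /dvgP; rewrite Slim => /eqP; apply/negP.
  by rewrite (_ : point = 0) // invr_neq0 // pnatr_eq0.
have Snd : nondecreasing_seq S.
  apply/nondecreasing_seqP => n; rewrite /S; case: n => [|n].
    by rewrite !big_geq.
  by rewrite [leRHS]big_nat_recr //= lerDl exprn_ge0 // ltW.
(* The index [m.+2] gives strictness: passing from [m.+1] to [m.+2] always adds a positive term,
   whereas the sums up to 0 and 1 are both empty. *)
have := nondecreasing_cvgn_le Snd Scvg m.+2; rewrite Slim; apply: lt_le_trans.
rewrite /S big_nat_recr //= ltr_pwDr ?exprn_gt0 //.
by have := Snd m m.+1 (leqnSn m).
Qed.

Lemma log_concave_decay (T : nat -> R) (t : R) m :
  (forall j, (j <= m)%N -> 0 < T j) -> 0 <= t ->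
  ((0 < m)%N -> T 1%N <= t * T 0%N) ->
  (forall j, (j.+2 <= m)%N -> T j * T j.+2 <= t ^+ 2 * T j.+1 ^+ 2) ->
  forall j, (j <= m)%N -> T j <= t ^+ (j ^ 2) * T 0%N.
Proof.
move=> T0 t0 T1 TT.
have ratio j : (j < m)%N -> T j.+1 <= t ^+ (2 * j + 1) * T j.
  elim: j => [|j IHj] jm; first by rewrite expr1 T1.
  rewrite -(ler_pM2l (T0 j _)); last by lia.
  apply: (le_trans (TT j _)); first by lia.
  have -> : (2 * j.+1 + 1 = 2 + (2 * j + 1))%N by lia.
  rewrite exprD; set x := t ^+ (2 * j + 1).
  have -> : T j * (t ^+ 2 * x * T j.+1) = t ^+ 2 * T j.+1 * (x * T j) by ring.
  rewrite [T _ ^+ 2]expr2 mulrA ler_wpM2l ?IHj //; last by lia.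
  by rewrite mulr_ge0 ?exprn_ge0 // ltW // T0 //; lia.
elim=> [|j IHj] jm; first by rewrite expr0 mul1r.
apply: (le_trans (ratio j jm)).
have -> : (j.+1 ^ 2 = (2 * j + 1) + j ^ 2)%N by rewrite -!mulnn; lia.
by rewrite (exprD t (2 * j + 1)) -mulrA ler_wpM2l ?exprn_ge0 // IHj // ltnW.
Qed.

Lemma dominant_term_theta (A : nat -> R) (t : R) n k : (1 <= k < n)%N -> 0 < t ->
  (forall m, \sum_(1 <= j < m) t ^+ (j ^ 2) < 2^-1) ->
  (forall j, (j <= n)%N -> 0 < A j) ->
  (forall j, (j.+2 <= n)%N -> A j * A j.+2 <= t ^+ 2 * A j.+1 ^+ 2) ->
  exists2 rho, 0 < rho & dominant_term n A k rho.
Proof.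
case: k => // k /andP[_ kn] t0 theta A0 AA.
have [Ak Ak2] : 0 < A k /\ 0 < A k.+2 by split; apply: A0; lia.
(* The dominant index is now [k.+1]. This radius equates the terms [k] and [k.+2], so that
   log-concavity bounds both by [t] times the term [k.+1], and the decay starts on both sides. *)
pose rho := Num.sqrt (A k / A k.+2).
have rho0 : 0 < rho by rewrite sqrtr_gt0 divr_gt0.
have rho2 : rho ^+ 2 = A k / A k.+2 by rewrite sqr_sqrtr // divr_ge0 // ltW.
exists rho => //; pose T j := A j * rho ^+ j.
have T0 j : (j <= n)%N -> 0 < T j.
  by move=> jn; rewrite /T mulr_gt0 ?exprn_gt0 ?A0.
have TT j : (j.+2 <= n)%N -> T j * T j.+2 <= t ^+ 2 * T j.+1 ^+ 2.
  move=> jn; have -> : T j * T j.+2 = A j * A j.+2 * rho ^+ (j.+1 * 2).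
    by rewrite /T mulrACA -exprD; congr (_ * rho ^+ _); lia.
  have -> : t ^+ 2 * T j.+1 ^+ 2 = t ^+ 2 * A j.+1 ^+ 2 * rho ^+ (j.+1 * 2).
    by rewrite /T exprMn exprM mulrA.
  by rewrite ler_pM2r ?exprn_gt0 // AA.
have Tk2 : T k = T k.+2.
  have rk2 : rho ^+ k.+2 = rho ^+ k * rho ^+ 2 by rewrite -exprD addn2.
  by rewrite /T rk2 rho2; field; rewrite gt_eqF.
have Tk1 : T k <= t * T k.+1.
  have := TT k kn; rewrite -Tk2 -expr2 -exprMn ler_pXn2r ?nnegrE //.
    by rewrite ltW // T0; lia.
  by rewrite mulr_ge0 ?ltW // T0; lia.
have up j : (k.+1 + j <= n)%N -> T (k.+1 + j)%N <= t ^+ (j ^ 2) * T k.+1.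
  move=> jn; rewrite -{2}(addn0 k.+1).
  apply: (log_concave_decay (fun i => T (k.+1 + i)%N) t (n - k.+1)); try lia.
  - by move=> i im; apply: T0; lia.
  - exact: ltW.
  - by rewrite addn1 addn0 -Tk2.
  - by move=> i im; rewrite !addnS; apply: TT; lia.
have down j : (j <= k.+1)%N -> T (k.+1 - j)%N <= t ^+ (j ^ 2) * T k.+1.
  move=> jk; rewrite -{2}(subn0 k.+1).
  apply: (log_concave_decay (fun i => T (k.+1 - i)%N) t k.+1) => //; try lia.
  - by move=> i im; apply: T0; lia.
  - exact: ltW.
  - by rewrite subn0 subn1.
  - move=> i im; have := TT (k.+1 - i.+2)%N; rewrite mulrC.
    have -> : ((k.+1 - i.+2).+2 = k.+1 - i)%N by lia.
    have -> : ((k.+1 - i.+2).+1 = k.+1 - i.+1)%N by lia.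
    by apply; lia.
have Tk0 : 0 < T k.+1 by apply: T0; lia.
rewrite /dominant_term -(big_mkord (fun j => j != k.+1) T).
rewrite (@big_cat_nat _ _ _ k.+1) //=; last by lia.
rewrite [X in _ + X]big_ltn_cond ?eqxx /=; last by lia.
rewrite -/(T k.+1) -[ltRHS]mul1r (splitr 1) mulrDl div1r.
have half m : \sum_(1 <= j < m) t ^+ (j ^ 2) * T k.+1 < 2^-1 * T k.+1.
  by rewrite -mulr_suml ltr_pM2r.
(* There are [k.+1] terms below the dominant one and [n - k.+1] above it; each group stays below
   half of it. *)
apply: ltrD; [apply: le_lt_trans (half k.+2)|apply: le_lt_trans (half (n.+1 - k.+1)%N)].
  rewrite big_add1 /= big_nat_rev big_nat_cond [leRHS]big_nat_cond.
  rewrite [leLHS](eq_bigl (fun i => (0 <= i < k.+1)%N && true)); last first.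
    by move=> i; lia.
  apply: ler_sum => i; rewrite andbT add0n => ik.
  by apply: down; lia.
rewrite -[k.+2]add1n big_addn big_nat_cond [leRHS]big_nat_cond.
rewrite [leLHS](eq_bigl (fun i => (1 <= i < n.+1 - k.+1)%N && true)); last first.
  by move=> i; lia.
apply: ler_sum => i; rewrite andbT => ik.
by rewrite addnC; apply: up; lia.
Qed.

End Dominance.

(** * Counting the zeros of a given modulus *)

(** Let [k] be the first index whose radius exceeds [t]. At most [k] zeros have modulus at most [t],
    and at most [n - k + 1] have modulus at least [t]. These counts add up to at most [n + 1], while
    their sum is [n] plus the number of zeros of modulus [t]. *)
Lemma count_modulus_le1 (R : realType) n (P : {poly R[i]}) (rs : seq R[i]) t :
  size P = n.+1 -> 0 \notin rs ->
  P = lead_coef P *: \prod_(z <- rs) ('X - z%:P) ->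
  (forall k, (1 <= k < n)%N ->
    exists2 rho, 0 < rho & dominant_term n (fun j => Normc.normc P`_j) k rho) ->
  (count (fun z => Normc.normc z == t) rs <= 1)%N.
Proof.
move=> Pn rs0 PE dom.
have P0 : P != 0 by rewrite -size_poly_eq0 Pn.
have rsn : size rs = n.
  by have := Pn; rewrite PE size_scale ?lead_coef_eq0 // size_prod_XsubC => -[].
have [/hasP[w wrs /eqP wt]|] := boolP (has (fun z => Normc.normc z == t) rs); last first.
  by rewrite has_count -leqNgt leqn0 => /eqP->.
have rootw : root P w.
  by rewrite PE rootZ ?lead_coef_eq0 // root_prod_XsubC.
pose below k := (k == n) || ((0 < k)%N &&
  `[< exists rho, [/\ 0 < rho, dominant_term n (fun j => Normc.normc P`_j) k rho & t < rho] >]).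
have exb : exists k, below k by exists n; rewrite /below eqxx.
case: (ex_minnP exb) => k bk mink.
have kn : (k <= n)%N by apply: mink; rewrite /below eqxx.
have k0 : (0 < k)%N.
  case/orP: bk => [/eqP->|/andP[]//].
  by rewrite -rsn; case: (rs) wrs.
have cle : (count (fun z => Normc.normc z <= t)%R rs <= k)%N.
  case/orP: bk => [/eqP->|/andP[_ /asboolP[rho [rho0 dk tr]]]].
    by rewrite -rsn count_size.
  apply: leq_trans (dominant_count_lt n P _ k rho rs rho0 kn PE _ dk); last by rewrite Pn.
  by apply: sub_count => z /= zt; apply: le_lt_trans tr.
have cge : (count (fun z => t <= Normc.normc z)%R rs <= n - k.-1)%N.
  have [k1|k1] := leqP k 1.
    by apply: leq_trans (count_size _ _) _; rewrite rsn; lia.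
  have [|rho rho0 dk] := dom k.-1; first by lia.
  have kn1 : (k.-1 <= n)%N by lia.
  apply: leq_trans (dominant_count_gt n P _ k.-1 rho rs rho0 kn1 PE rsn rs0 dk).
  apply: sub_count => z /=; apply: lt_le_trans.
  (* The radius of [k.-1] is not [t], since the root [w] has modulus [t], and it is not larger, by
     minimality of [k]. *)
  rewrite lt_neqAle; apply/andP; split.
    rewrite eq_sym -wt; apply: dominant_not_root kn1 dk rootw.
    by rewrite Pn.
  rewrite leNgt; apply/negP => tr.
  suff : below k.-1 by move/mink; lia.
  apply/orP; right; apply/andP; split; first by lia.
  by apply/asboolP; exists rho.
have := count_predUI (fun z => Normc.normc z <= t)%R (fun z => t <= Normc.normc z)%R rs.
rewrite (eq_count (a2 := predT)); last by move=> z /=; rewrite le_total.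
rewrite [X in (_ + X)%N](eq_count (a2 := fun z => Normc.normc z == t)); last first.
  by move=> z /=; rewrite eq_le.
rewrite count_predT rsn; lia.
Qed.

Theorem corollary1p2 (R : realType) (n : nat) (P : {poly R[i]})
  (hn : (2 <= n)%N) (degP : size P = n.+1)
  (coefP : forall k : nat, (k <= n)%N -> P`_k != 0)
  (hq : forall k : nat, (2 <= k <= n)%N ->
    (b_infty R)%:C <= `|second_quotient P k|) :
  (forall z : R[i], root P z -> mup z P = 1%N) /\
  (forall z w : R[i], root P z -> root P w -> z != w -> `|z| != `|w|).
Proof.
have P0 : P != 0 by rewrite -size_poly_eq0 degP.
have [rs PE] := closed_field_poly_normal P.
have lc0 : lead_coef P != 0 by rewrite lead_coef_eq0.
have mem_rs z : root P z = (z \in rs) by rewrite PE rootZ // root_prod_XsubC.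
have rs0 : 0 \notin rs by rewrite -mem_rs /root horner_coef0 coefP.
have [t t0 [tb theta]] := @b_infty_theta R.
have A0 j : (j <= n)%N -> 0 < Normc.normc P`_j by move/coefP; rewrite normc_gt0.
have dom k : (1 <= k < n)%N ->
    exists2 rho, 0 < rho & dominant_term n (fun j => Normc.normc P`_j) k rho.
  move=> kn; apply: (dominant_term_theta _ t n k kn t0 theta A0) => j jn.
  (* Since [b_infty] is [t ^- 2], the bound on the second quotient of index [j.+2] is the
     log-concavity of the moduli with factor [t ^+ 2]. *)
  have := hq j.+2; rewrite jn => /(_ isT).
  rewrite /second_quotient !subSS !subn0 -tb lecR.
  rewrite Normc.normcM normcX Normc.normcV Normc.normcM.
  have Ajj : 0 < Normc.normc P`_j * Normc.normc P`_j.+2.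
    by rewrite mulr_gt0 //; apply: A0; lia.
  by rewrite ler_pdivlMr // ler_pdivrMl // exprn_gt0.
have cnt s := count_modulus_le1 R n P rs s degP rs0 PE dom.
split=> [z|z w].
  rewrite mem_rs => zrs; have := cnt (Normc.normc z).
  (* A multiple zero occurs several times in [rs], always with the same modulus, so [cnt] excludes
     it. *)
  have -> : mup z P = count_mem z rs.
    rewrite PE -mul_polyC mupMr ?mu_prod_XsubC //.
    by rewrite rootC.
  have : (0 < count_mem z rs)%N by rewrite -has_count has_pred1.
  have : (count_mem z rs <= count (fun w => Normc.normc w == Normc.normc z) rs)%N.
    by apply: sub_count => w /= /eqP ->.
  lia.
(* The norm is a complex number with real part [Normc.normc]; injection extracts the equality of the
   real moduli. *)
rewrite !mem_rs => zrs wrs zw; apply/eqP => -[zwn].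
have := cnt (Normc.normc z); rewrite leqNgt => /negP; apply.
have : (0 < count_mem z rs)%N by rewrite -has_count has_pred1.
have : (0 < count_mem w rs)%N by rewrite -has_count has_pred1.
have := count_predUI (pred1 z) (pred1 w) rs.
rewrite (@eq_count _ (predI _ _) pred0) ?count_pred0 ?addn0; last first.
  by move=> x /=; apply/negP => /andP[/eqP-> /eqP]; exact/eqP.
have : (count (predU (pred1 z) (pred1 w)) rs <=
        count (fun x => Normc.normc x == Normc.normc z) rs)%N.
  by apply: sub_count => x /= /orP[] /eqP ->; rewrite // zwn.
lia.
Qed.
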